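(* Let $\Delta$ be a shifted simplicial complex on a finite vertex set $V$ of integers. Then $\Delta$ satisfies the spectral recursion; that is, for every $e\in V$, $$S_\Delta(t,q) = q\,S_{\Delta-e}(t,q) + qt\,S_{\Delta/e}(t,q) + (1-q)\,S_{(\Delta-e,\Delta/e)}(t,q).$$
   Context: A simplicial complex $\Delta$ on a finite vertex set $V$ is a collection of subsets of $V$ (faces) closed under taking subsets. The empty set is a face (of dimension $-1$) of every complex that has at least one face; the empty complex $\emptyset$ (no faces at all) is allowed; an element $v\in V$ need not satisfy $\{v\}\in\Delta$. Put $\dim F=|F|-1$, and let $\Delta_i$ be the set of $i$-dimensional faces. A simplicial pair $(\Delta,\Delta')$ consists of two simplicial complexes on the same vertex set; pairs with the same set difference $\Delta\setminus\Delta'$ are identified, and a single complex $\Delta$ is the pair $(\Delta,\emptyset)$. For $i\ge -1$, $C_i(\Delta,\Delta';\mathbb R)$ is the real vector space of formal linear combinations of oriented $i$-dimensional faces $[F]$, $F\in\Delta\setminus\Delta'$, and $\partial_i\colon C_i\to C_{i-1}$ is the usual signed simplicial boundary operator with all terms outside $\Delta\setminus\Delta'$ dropped; $\partial_i^*$ is its adjoint (transposed matrix in the natural bases). The Laplacian is $L_i(\Delta,\Delta')=\partial_{i+1}\partial_{i+1}^*+\partial_i^*\partial_i$, and $\mathbf s_i(\Delta,\Delta')$ is the multiset of its eigenvalues (non-negative reals). The spectrum polynomial is the generating function $$S_{(\Delta,\Delta')}(t,q)=\sum_{i\ge 0}t^i\sum_{\lambda\in\mathbf s_{i-1}(\Delta,\Delta')}q^\lambda,\qquad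 S_\Delta=S_{(\Delta,\emptyset)}$$ (exponents of $q$ may a priori be arbitrary non-negative reals). For $e\in V$, the deletion $\Delta-e=\{F\in\Delta: e\notin F\}$ and the contraction $\Delta/e=\{F\setminus\{e\}: F\in\Delta,\ e\in F\}$ are simplicial complexes on vertex set $V\setminus\{e\}$. For $k$-subsets $F=\{f_1<\cdots<f_k\}$ and $G=\{g_1<\cdots<g_k\}$ of the vertex set $V$ (a finite set of integers), write $F\le_P G$ if $f_p\le g_p$ for all $p$. A family $\mathcal K$ of $k$-subsets of $V$ is shifted if $F\le_P G$ and $G\in\mathcal K$ imply $F\in\mathcal K$. The complex $\Delta$ is shifted if $\Delta_i$ is shifted for every $i$. *)

(* Defs.v *)
From HB Require Import structures.
From mathcomp Require Import all_boot all_order all_algebra.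
From mathcomp Require Import polyrcf.
From mathcomp Require Import finmap.
From mathcomp.multinomials Require Import monalg.

Set Implicit Arguments.
Unset Strict Implicit.
Unset Printing Implicit Defensive.

Import Order.TTheory GRing.Theory Num.Theory.

Local Open Scope fset_scope.
Local Open Scope ring_scope.

Definition is_complex (V : {fset int}) (D : {fset {fset int}}) : Prop :=
  (forall F, F \in D -> F `<=` V) /\
  (forall F G, F \in D -> G `<=` F -> G \in D).

Definition deletion (D : {fset {fset int}}) (e : int) : {fset {fset int}} :=
  [fset F in D | e \notin F].

Definition contraction (D : {fset {fset int}}) (e : int) : {fset {fset int}} :=
  [fset F `\ e | F in [fset F in D | e \in F]].

Lemma is_complex_deletion V D e :
  is_complex V D -> is_complex (V `\ e) (deletion D e).
Proof.
move=> [DV Dd]; split=> [F|F G]; rewrite !inE => /andP[FD eF].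
  apply/fsubsetP=> x xF; rewrite !inE; apply/andP; split.
    by apply: contraNneq eF => <-.
  exact: (fsubsetP (DV F FD)).
move=> GF; rewrite (Dd _ _ FD GF) /=.
by apply: contra eF; apply: (fsubsetP GF).
Qed.

Lemma is_complex_contraction V D e :
  is_complex V D -> is_complex (V `\ e) (contraction D e).
Proof.
move=> [DV Dd]; split=> [F|F G] /imfsetP[/= H]; rewrite !inE => /andP[HD eH] ->.
  exact/fsetSD/DV.
move=> GH; have eG : e \notin G.
  by apply/negP => /(fsubsetP GH); rewrite !inE eqxx.
apply/imfsetP; exists (e |` G) => /=; last first.
  by apply/fsetP => x; rewrite !inE; case: eqVneq => [->|//]; apply/negbTE.
rewrite !inE eqxx /= andbT; apply: Dd HD _.
apply/fsubsetP => x; rewrite !inE => /orP[/eqP->//|/(fsubsetP GH)].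
by rewrite !inE => /andP[].
Qed.

Definition fdim (F : {fset int}) : int := #|` F|%:Z - 1.

Definition faces (D : {fset {fset int}}) (i : int) : {fset {fset int}} :=
  [fset F in D | fdim F == i].

(* Faces are oriented by the increasing order of their vertices. At most one
   term of the sum is present. *)
Definition incidence (R : pzRingType) (G F : {fset int}) : R :=
  \sum_(v <- F | G == F `\ v) (-1) ^+ #|` [fset u in F | (u < v)%R]|.

(* The matrix of the boundary map from the span of A to the span of B, acting
   on column vectors; facets outside B are dropped. *)
Definition boundary (R : pzRingType) (A B : {fset {fset int}}) :
    'M[R]_(#|` B|, #|` A|) :=
  \matrix_(i, j) incidence R (nth fset0 B i) (nth fset0 A j).

Definition laplacian (R : pzRingType) (D D' : {fset {fset int}}) (i : int) :
    'M[R]_(#|` faces (D `\` D') i|) :=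
  let C := faces (D `\` D') in
  boundary R (C (i + 1)) (C i) *m (boundary R (C (i + 1)) (C i))^T
  + (boundary R (C i) (C (i - 1)))^T *m boundary R (C i) (C (i - 1)).

(* The multiset of eigenvalues in R, listed with algebraic multiplicity. *)
Definition eigenvalues (R : rcfType) (n : nat) (A : 'M[R]_n) : seq R :=
  flatten [seq nseq (mup a (char_poly A)) a | a <- rootsR (char_poly A)].

Definition spectrum (R : rcfType) (D D' : {fset {fset int}}) (i : int) : seq R :=
  eigenvalues (laplacian R D D' i).

Lemma laplacian_eigenvalue_ge0 (R : rcfType) D D' i (a : R) :
  eigenvalue (laplacian R D D' i) a -> 0 <= a.
Proof.
have sq_ge0 m (w : 'rV[R]_m) : 0 <= (w *m w^T) 0 0.
  by rewrite mxE sumr_ge0 // => k _; rewrite mxE -expr2 sqr_ge0.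
case/eigenvalueP => v vL v0.
have v_gt0 : 0 < (v *m v^T) 0 0.
  rewrite lt_def sq_ge0 andbT; apply: contra_neq v0 => h; apply/rowP => j.
  rewrite mxE; move: h; rewrite mxE => /eqP; rewrite psumr_eq0; last first.
    by move=> k _; rewrite mxE -expr2 sqr_ge0.
  move=> /allP/(_ j (mem_index_enum _)); rewrite mxE -expr2 sqrf_eq0 /=.
  by move/eqP.
have : 0 <= (v *m laplacian R D D' i *m v^T) 0 0.
  rewrite /laplacian /= mulmxDr mulmxDl mxE addr_ge0 //.
    set B := boundary _ _ _.
    by rewrite !mulmxA -mulmxA -trmx_mul sq_ge0.
  set B := boundary _ _ _.
  have -> : v *m (B^T *m B) *m v^T = (v *m B^T) *m (v *m B^T)^T.
    by rewrite trmx_mul trmxK !mulmxA.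
  exact: sq_ge0.
by rewrite vL -scalemxAl mxE pmulr_lge0.
Qed.

Lemma spectrum_ge0 (R : rcfType) D D' i (a : R) :
  a \in spectrum R D D' i -> 0 <= a.
Proof.
case/flatten_mapP => b; rewrite /rootsR => /root_roots rb.
by rewrite mem_nseq => /andP[_ /eqP->]; apply: laplacian_eigenvalue_ge0;
  rewrite eigenvalue_root_char; apply: rb.
Qed.

(* The monoid of formal powers q^x with x >= 0, so that {malg int[qmon R]} is
   the ring of finite integer combinations of such powers. *)
Record qmon (R : numDomainType) := QMon { qexp : R; qexp_ge0 : 0 <= qexp }.

HB.instance Definition _ (R : numDomainType) := [isSub for @qexp R].
HB.instance Definition _ (R : numDomainType) := [Choice of qmon R by <:].

Section QMon.
Variable R : numDomainType.

Definition qmon1 : qmon R := QMon (lexx 0).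
Definition qmonM (x y : qmon R) : qmon R :=
  QMon (addr_ge0 (qexp_ge0 x) (qexp_ge0 y)).

Lemma qmonA : associative qmonM.
Proof. by move=> x y z; apply/val_inj; rewrite /= addrA. Qed.

Lemma qmon1l : left_id qmon1 qmonM.
Proof. by move=> x; apply/val_inj; rewrite /= add0r. Qed.

Lemma qmonC : commutative qmonM.
Proof. by move=> x y; apply/val_inj; rewrite /= addrC. Qed.

Lemma qmon1r : right_id qmon1 qmonM.
Proof. by move=> x; rewrite qmonC qmon1l. Qed.

Lemma qmon_unit x y : qmonM x y = qmon1 -> x = qmon1 /\ y = qmon1.
Proof.
move=> /(congr1 val) /= /eqP.
rewrite paddr_eq0 ?qexp_ge0 // => /andP[/eqP x0 /eqP y0].
by split; apply/val_inj.
Qed.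
End QMon.

HB.instance Definition _ (R : numDomainType) :=
  Choice_isMonomialDef.Build (qmon R)
    (@qmonA R) (@qmon1l R) (@qmon1r R) (@qmon_unit R).
HB.instance Definition _ (R : numDomainType) :=
  MonomialDef_isConomialDef.Build (qmon R) (@qmonC R).

(* q^x; the junk value 1 at x < 0 is never used, by spectrum_ge0. *)
Definition qpow (R : numDomainType) (x : R) : {malg int[qmon R]} :=
  << insubd (qmon1 R) x >>.

(* Polynomials in t whose coefficients are polynomials in q with real
   exponents. *)
Definition tqpoly (R : numDomainType) := {poly {malg int[qmon R]}}.
Definition tvar (R : numDomainType) : tqpoly R := 'X.
Definition qvar (R : numDomainType) : tqpoly R := (qpow 1)%:P.

(* The bound only truncates zero coefficients: there are no (i - 1)-dimensional
   faces beyond it. *)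
Definition spectrum_poly (R : rcfType) (D D' : {fset {fset int}}) : tqpoly R :=
  \poly_(i < (\max_(F <- D `\` D') #|` F|).+1)
    \sum_(x <- spectrum R D D' (i%:Z - 1)) qpow x.

(* Componentwise comparison of the increasing enumerations; all2 also requires
   equal cardinalities. *)
Definition le_P (F G : {fset int}) : bool :=
  all2 <=%R (sort <=%R F) (sort <=%R G).

Definition shifted_family (V : {fset int}) (K : {fset {fset int}}) : Prop :=
  forall F G, F `<=` V -> G \in K -> le_P F G -> F \in K.

Definition shifted (V : {fset int}) (D : {fset {fset int}}) : Prop :=
  forall i : int, shifted_family V (faces D i).

(* Main.v *)
(* For a shifted family the nonzero eigenvalues of the Gram matrix of the
   boundary map form the conjugate partition of the degree sequence, which
   amounts to the linear formula
     \sum_lambda (q^lambda - 1) = (q - 1) \sum_j q^#{u in V : u < j} deg(j).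
   More generally this holds for the boundary from a shifted K to the complement
   of a shifted K', with deg(j) = #{F in K : j in F, F - j not in K'}.  Induct on
   V: with m = min V and N = (K/m) \ K', shiftedness lets the boundary matrix
   factor through N in such a way that its Gram matrix has the same nonzero
   eigenvalues as 1 + X X^T + Y^T Y, where X and Y are the boundary matrices of
   the deletion and of the contraction of (K, K') by m, and Y X = 0.  Since
   orthogonal summands contribute their nonzero eigenvalues separately, each
   vertex other than m is shifted by one position and the constant 1 accounts
   for deg(m) = #N.  The Laplacian is again such a sum of two orthogonal Gram
   matrices, so the spectral recursion at an arbitrary e reduces to an identity
   between degrees: for the pair (D - e, D/e), deg(j) is deg_D(j) - deg_D(e) if
   j < e, and 0 if j > e. *)

Require Import Defs.
From mathcomp Require Import all_boot all_order all_algebra.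
From mathcomp Require Import finmap reals.
From mathcomp.multinomials Require Import monalg.
From mathcomp Require Import polyrcf ring.

Set Implicit Arguments.
Unset Strict Implicit.
Unset Printing Implicit Defensive.

Import Order.TTheory GRing.Theory Num.Theory.

Local Open Scope fset_scope.
Local Open Scope ring_scope.

(** * Eigenvalues of matrix products and sums *)

Lemma shift_identity (A : comNzRingType) (q s n : A) :
  q * s - n = q * (s - n) + (q - 1) * n.
Proof. by ring. Qed.

Section SpectralDefect.
Variable R : rcfType.
Local Notation Q := {malg int[qmon R]}.
Local Notation q := (qpow (1 : R) : Q).

Lemma qpow0 : qpow (0 : R) = 1.
Proof.
rewrite /qpow; have -> : insubd (qmon1 R) (0 : R) = qmon1 R.
  by apply: val_inj; rewrite insubdK // /in_mem /= lexx.
by [].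
Qed.

Lemma qpowS (x : R) : 0 <= x -> qpow (1 + x) = q * qpow x.
Proof.
move=> x0; rewrite /qpow malgM_def fgmulUU mulr1; congr (<< _ >>).
apply: val_inj; rewrite /= !insubdK // /in_mem /=; first exact: ler01.
by rewrite addr_ge0 // ler01.
Qed.

Lemma char_poly_neq0 n (A : 'M[R]_n) : char_poly A != 0.
Proof. by rewrite monic_neq0 ?char_poly_monic. Qed.

Lemma count_eigenvalues n (A : 'M[R]_n) a :
  count_mem a (eigenvalues A) = mup a (char_poly A).
Proof.
rewrite /eigenvalues; move: (char_poly A) (char_poly_neq0 A) => p p0.
have ru : uniq (rootsR p) by rewrite /rootsR uniq_roots.
rewrite count_flatten -map_comp.
have -> : [seq (count_mem a \o (fun b => nseq (mup b p) b)) b | b <- rootsR p] =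
   [seq if b == a then mup a p else 0%N | b <- rootsR p].
  apply: eq_map => b /=; rewrite count_nseq /=.
  rewrite mulnbl.
  by have [->|_] := eqVneq b a.
rewrite sumnE big_map.
have [ra|nra] := boolP (root p a).
  have ain : a \in rootsR p.
    by rewrite -roots_on_rootsR //= ra andbT in_itv.
  rewrite (bigD1_seq a) //= eqxx big1 ?addn0 // => b /negbTE.
  by move=> ->.
by rewrite mupNroot // big1 // => b _; case: ifP.
Qed.

Lemma mupXn n (a : R) : mup a ('X^n) = if a == 0 then n else 0%N.
Proof. by have := mup_XsubCX n a 0; rewrite subr0 eq_sym. Qed.

(** Multiplying [block_mx 'X%:M a b 1%:M] by block triangular matrices, once on the right and once
    on the left, computes its determinant in two ways. *)
Lemma char_poly_mulC m n (A : 'M[R]_(m, n)) (B : 'M[R]_(n, m)) :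
  'X^n * char_poly (A *m B) = 'X^m * char_poly (B *m A).
Proof.
rewrite /char_poly /char_poly_mx !map_mxM.
set a := map_mx _ A; set b := map_mx _ B.
have E1 : block_mx 'X%:M a b 1%:M *m block_mx 1%:M 0 (- b) 1%:M
   = block_mx ('X%:M - a *m b) a 0 1%:M.
  rewrite mulmx_block !mulmx0 !mulmx1 !mul1mx mulmxN !add0r.
  by rewrite addrN.
have E2 : block_mx 1%:M 0 (- b) 'X%:M *m block_mx 'X%:M a b 1%:M
   = block_mx 'X%:M a 0 ('X%:M - b *m a).
  rewrite mulmx_block !mul0mx !mulmx1 !mul1mx !mulNmx !addr0.
  by rewrite -scalar_mxC addNr addrC.
move: (congr1 determinant E1) (congr1 determinant E2).
rewrite !det_mulmx !det_ublock !det_lblock !det1 !mulr1 !mul1r !det_scalar => ->.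
by [].
Qed.

(** Since AB = 0, (X - A)(X - B) = X(X - A - B). *)
Lemma char_poly_add_orth n (A B : 'M[R]_n) : A *m B = 0 ->
  'X^n * char_poly (A + B) = char_poly A * char_poly B.
Proof.
move=> AB0; rewrite /char_poly /char_poly_mx -det_mulmx -det_scalar -det_mulmx.
congr (\det _); rewrite map_mxD mulmxBl !mulmxBr -map_mxM AB0 map_mx0 subr0.
by rewrite mulmxDr opprD addrA -(scalar_mxC 'X (map_mx _ A)) addrAC.
Qed.

Lemma char_poly_add1 n (A : 'M[R]_n) :
  char_poly (1%:M + A) = char_poly A \Po ('X - 1%:P).
Proof.
rewrite /char_poly -[RHS]/(comp_poly _ _) -det_map_mx; congr (\det _).
apply/matrixP => i j; rewrite !mxE /= rmorphB rmorphMn /= comp_polyX comp_polyC.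
by rewrite polyCD polyCMn opprD addrA mulrnBl.
Qed.

(** Substituting X - c carries divisibility by powers of X - (a - c) to divisibility by powers of X
    - a; the inverse substitution X + c gives the opposite inequality. *)
Lemma mup_shift (p : {poly R}) (c a : R) : p != 0 ->
  mup a (p \Po ('X - c%:P)) = mup (a - c) p.
Proof.
move=> p0.
have comp_shift (b d : R) : ('X - b%:P) \Po ('X - d%:P) = 'X - (b + d)%:P.
  by rewrite comp_polyB comp_polyX comp_polyC polyCD opprD addrA addrAC.
have shiftK : (p \Po ('X - c%:P)) \Po ('X + c%:P) = p.
  rewrite -comp_polyA; have -> : ('X - c%:P) \Po ('X + c%:P) = 'X.
    by rewrite comp_polyB comp_polyX comp_polyC addrK.
  exact: comp_polyXr.
have pc0 : p \Po ('X - c%:P) != 0.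
  by apply: contra_neq p0 => pc0; rewrite -shiftK pc0 comp_poly0.
have comp_exp k (r t : {poly R}) : (r \Po t) ^+ k = r ^+ k \Po t.
  by rewrite -[RHS]/(comp_poly t _) rmorphXn.
have dvd_comp (r s t : {poly R}) : r %| s -> r \Po t %| s \Po t.
  by move=> /dvdpP[u ->]; rewrite comp_polyM dvdp_mull.
apply/eqP; rewrite eqn_leq !mup_geq //; apply/andP; split; last first.
  rewrite -[X in 'X - X%:P](subrK c a) -comp_shift comp_exp.
  by apply: dvd_comp; rewrite -mup_geq.
rewrite -[X in _ %| X]shiftK; have -> : 'X + c%:P = 'X - (- c)%:P.
  by rewrite polyCN opprK.
rewrite -comp_shift comp_exp; apply: dvd_comp.
by rewrite -mup_geq.
Qed.

Lemma eigenvalue_eigenvalues n (A : 'M[R]_n) a :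
  a \in eigenvalues A -> eigenvalue A a.
Proof.
by move=> /flatten_mapP[b /root_roots rb]; rewrite mem_nseq eigenvalue_root_char
  => /andP[_ /eqP->].
Qed.

Lemma gram_eigenvalue_ge0 m n (A : 'M[R]_(m, n)) a :
  a \in eigenvalues (A *m A^T) -> 0 <= a.
Proof.
have sq_ge0 k (w : 'rV[R]_k) : 0 <= (w *m w^T) 0 0.
  by rewrite mxE sumr_ge0 // => i _; rewrite mxE -expr2 sqr_ge0.
move/eigenvalue_eigenvalues/eigenvalueP => [v vA v0].
have v_gt0 : 0 < (v *m v^T) 0 0.
  rewrite lt_def sq_ge0 andbT; apply: contra_neq v0 => h; apply/rowP => j.
  move: h; rewrite !mxE => /eqP; rewrite psumr_eq0 => [|i _].
    by move=> /allP/(_ j (mem_index_enum _)); rewrite mxE -expr2 sqrf_eq0 => /eqP.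
  by rewrite mxE -expr2 sqr_ge0.
have := sq_ge0 _ (v *m A).
by rewrite trmx_mul mulmxA -(mulmxA v) vA -scalemxAl mxE pmulr_lge0.
Qed.

(* Subtracting n makes the eigenvalue 0 contribute nothing, so that the products
   A *m B and B *m A of different sizes have the same defect. *)
Definition defect n (A : 'M[R]_n) : Q :=
  \sum_(x <- eigenvalues A) qpow x - n%:R.

Lemma sum_qpow_eigenvalues n (A : 'M[R]_n) :
  \sum_(x <- eigenvalues A) qpow x = n%:R + defect A.
Proof. by rewrite /defect addrC subrK. Qed.

Lemma sum_qpow_nseq n : \sum_(x <- nseq n (0 : R)) qpow x = n%:R.
Proof. by rewrite big_nseq qpow0 iter_addr_0. Qed.

Lemma sum_qpow_perm (s1 s2 : seq R) : perm_eq s1 s2 ->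
  \sum_(x <- s1) qpow x = \sum_(x <- s2) qpow x.
Proof. exact: perm_big. Qed.

(** By [char_poly_mulC] the two eigenvalue lists agree once padded with n and m zeros. Each zero
    contributes q^0 = 1, so the subtracted sizes absorb the padding. *)
Lemma defect_mulC m n (A : 'M[R]_(m, n)) (B : 'M[R]_(n, m)) :
  defect (A *m B) = defect (B *m A).
Proof.
have P : perm_eq (nseq n 0 ++ eigenvalues (A *m B))
                 (nseq m 0 ++ eigenvalues (B *m A)).
  apply/allP => a _ /=; apply/eqP; have := congr1 (mup a) (char_poly_mulC A B).
  rewrite !mupM ?expf_neq0 ?polyX_eq0 ?char_poly_neq0 // !mupXn.
  by rewrite !count_cat !count_eigenvalues !count_nseq /= !mulnbl !(eq_sym 0).
have := sum_qpow_perm P.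
rewrite !big_cat /= !sum_qpow_nseq !sum_qpow_eigenvalues /=.
by rewrite addrCA => /addrI/addrI.
Qed.

(** The same padding argument: n zeros on the left make up for the 2n eigenvalues on the right. *)
Lemma defect_add_orth n (A B : 'M[R]_n) : A *m B = 0 ->
  defect (A + B) = defect A + defect B.
Proof.
move=> AB0.
have P : perm_eq (nseq n 0 ++ eigenvalues (A + B))
                 (eigenvalues A ++ eigenvalues B).
  apply/allP => a _ /=; apply/eqP.
  have := congr1 (mup a) (char_poly_add_orth AB0).
  rewrite !mupM ?expf_neq0 ?polyX_eq0 ?char_poly_neq0 // !mupXn.
  by rewrite !count_cat !count_eigenvalues !count_nseq /= !mulnbl !(eq_sym 0).
have := sum_qpow_perm P.
rewrite !big_cat /= !sum_qpow_nseq !sum_qpow_eigenvalues /=.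
by rewrite [in RHS]addrACA -addrA => /addrI/addrI.
Qed.

Lemma defect0 n : defect (0 : 'M[R]_n) = 0.
Proof.
have := defect_add_orth (mulmx0 n (0 : 'M[R]_n)).
by rewrite addr0 -{1}[defect _]addr0 => /addrI/esym.
Qed.

(** Nonnegativity keeps [qpow] away from its junk value, so adding 1 to an eigenvalue multiplies its
    power by q. The last term arises because n, rather than qn, is subtracted. *)
Lemma defect_add1 n (A : 'M[R]_n) : (forall a, a \in eigenvalues A -> 0 <= a) ->
  defect (1%:M + A) = q * defect A + (q - 1) * n%:R.
Proof.
move=> A_ge0.
have P : perm_eq (eigenvalues (1%:M + A)) [seq 1 + x | x <- eigenvalues A].
  apply/allP => a _ /=; rewrite count_map count_eigenvalues char_poly_add1.
  rewrite mup_shift ?char_poly_neq0 // -count_eigenvalues; apply/eqP.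
  by apply: eq_count => x /=; rewrite [RHS]eq_sym -subr_eq addrC eq_sym opprK.
rewrite /defect (sum_qpow_perm P) big_map.
have -> : \sum_(x <- eigenvalues A) qpow (1 + x)
        = q * \sum_(x <- eigenvalues A) qpow x.
  by rewrite mulr_sumr; apply: eq_big_seq => x /A_ge0; apply: qpowS.
exact: shift_identity.
Qed.
End SpectralDefect.

(** * The simplicial boundary *)

Lemma in_deletion D e F : (F \in deletion D e) = (F \in D) && (e \notin F).
Proof. by rewrite !inE. Qed.

Lemma in_contraction D e H :
  (H \in contraction D e) = (e \notin H) && (e |` H \in D).
Proof.
apply/imfsetP/andP => /= [[F]|[eH HD]].
  rewrite !inE => /andP[FD eF] ->; split; last by rewrite fsetD1K.
  by rewrite !inE eqxx.
exists (e |` H); first by rewrite !inE HD eqxx.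
by rewrite fsetU1K.
Qed.

Lemma deletion_fset0 e : deletion fset0 e = fset0.
Proof. by apply/fsetP => F; rewrite in_deletion !inE. Qed.

Lemma contraction_fset0 e : contraction fset0 e = fset0.
Proof. by apply/fsetP => F; rewrite in_contraction !inE andbF. Qed.

Lemma big_deletion_contraction (A : nmodType) (D : {fset {fset int}}) e
    (f : {fset int} -> A) :
  \sum_(F <- D) f F = \sum_(F <- deletion D e) f F
                      + \sum_(H <- contraction D e) f (e |` H).
Proof.
rewrite (bigID (fun F => e \notin F)) /=; congr (_ + _).
  by rewrite /deletion -big_fset_condE.
rewrite -(big_map (fun H => e |` H) xpredT f) -[LHS]big_filter.
apply: (perm_big (I:={fset int})).
apply: uniq_perm; first exact/filter_uniq/fset_uniq.
  rewrite map_inj_in_uniq ?fset_uniq // => H H'.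
  rewrite !in_contraction => /andP[eH _] /andP[eH' _] E.
  by rewrite -(fsetU1K eH) E fsetU1K.
move=> F; rewrite mem_filter negbK; apply/andP/mapP => [[eF FD]|[H]].
  exists (F `\ e); last by rewrite fsetD1K.
  by rewrite in_contraction fsetD1K // FD !inE eqxx.
by rewrite in_contraction => /andP[_ HD] ->; rewrite !inE eqxx.
Qed.

Section Incidence.
Variable R : rcfType.
Implicit Types (F G H : {fset int}) (A B C D : {fset {fset int}}).
Local Notation inc := (incidence R).

Definition vsign F v : R := (-1) ^+ #|` [fset u in F | (u < v)%R]|.

Lemma incidenceE G F : inc G F = \sum_(v <- F | G == F `\ v) vsign F v.
Proof. by []. Qed.

Lemma fsetD1_inj F v w : v \in F -> w \in F -> F `\ v = F `\ w -> v = w.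
Proof.
move=> vF wF /fsetP/(_ v); rewrite !inE eqxx vF !andbT /=.
by move/esym/negbFE/eqP.
Qed.

Lemma incidence_facet F v : v \in F -> inc (F `\ v) F = vsign F v.
Proof.
move=> vF; rewrite incidenceE big_mkcond (big_fsetD1 v) //= eqxx.
rewrite big1_seq ?addr0 // => w /=.
case: eqP => // E; rewrite !inE => /andP[/eqP wv wF].
by case: wv; apply: (fsetD1_inj wF vF).
Qed.

Lemma incidence_eq0 G F : (forall v, v \in F -> G != F `\ v) -> inc G F = 0.
Proof. by move=> GF; rewrite incidenceE big1_seq // => v /andP[E /GF/negP[]]. Qed.

Lemma sum_mul_incidence A (f : {fset int} -> R) F :
  \sum_(H <- A) f H * inc H F = \sum_(v <- F | F `\ v \in A) f (F `\ v) * vsign F v.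
Proof.
under eq_bigr => H _ do rewrite incidenceE big_distrr /= big_mkcond /=.
rewrite exchange_big [RHS]big_mkcond /=; apply: eq_bigr => v _.
case: ifP => [vA|vA].
  rewrite (big_fsetD1 (F `\ v)) //= eqxx big1_seq ?addr0 // => H /=.
  by rewrite !inE => /andP[/negbTE->].
by rewrite big1_seq // => H /=; case: eqP => // ->; rewrite vA.
Qed.

Lemma vsignD1 F v w : v \in F ->
  vsign (F `\ v) w = (-1) ^+ (v < w)%R * vsign F w.
Proof.
move=> vF; rewrite /vsign.
have -> : [fset u in F `\ v | (u < w)%R] = [fset u in F | (u < w)%R] `\ v.
  by apply/fsetP => u; rewrite !inE; case: (u == v).
rewrite [in RHS](cardfsD1 v) !inE vF /= exprD mulrA -expr2 -exprM.
by rewrite mulnC exprM sqrrN !expr1n mul1r.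
Qed.

(** The relation ∂∂ = 0 survives restricting the middle faces to A, provided A holds every face
    strictly between G and F. *)
Lemma sum_incidence_sq A G F :
    (forall v w, v \in F -> w \in F `\ v -> G = F `\ v `\ w -> F `\ v \in A) ->
  \sum_(H <- A) inc G H * inc H F = 0.
Proof.
move=> GA; rewrite sum_mul_incidence.
(* [T v w] is the signed contribution of removing v and then w from F. *)
pose T v w := if (w != v) && (G == F `\ v `\ w) then
  (-1) ^+ (v < w)%R * vsign F w * vsign F v else 0.
transitivity (\sum_(v <- F) \sum_(w <- F) T v w).
  rewrite big_mkcond /=; apply: eq_big_seq => v vF.
  have -> : \sum_(w <- F) T v w = inc G (F `\ v) * vsign F v.
    rewrite incidenceE big_distrl /= [in RHS]big_mkcond (big_fsetD1 v) //=.
    rewrite {1}/T eqxx add0r; apply: eq_big_seq => w.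
    rewrite !inE => /andP[wv wF]; rewrite /T wv /=; case: ifP => // _.
    by rewrite vsignD1.
  case: ifPn => // FA; rewrite incidence_eq0 ?mul0r // => w wF.
  by apply: contra FA => /eqP; apply: GA.
(* Swapping v and w changes the sign of [T], so the sum equals its own negative. *)
set S := (LHS); suff : - S == S by rewrite eqNr => /eqP.
rewrite {2}/S exchange_big /= -sumrN; apply/eqP.
apply: eq_bigr => v _; rewrite -sumrN; apply: eq_bigr => w _.
rewrite /T eq_sym; have [vw|vw] := eqVneq w v; first by rewrite oppr0.
have -> : F `\ w `\ v = F `\ v `\ w by rewrite fsetDDl fsetUC -fsetDDl.
case: ifP => _; last by rewrite oppr0.
rewrite mulrAC -!mulNr; congr (_ * _ * _).
by move: vw; case: ltgtP => //= _ _; rewrite ?opprK.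
Qed.

Lemma vsign_min m H : {in H, forall u, (m <= u)%R} -> vsign H m = 1.
Proof.
move=> mH; rewrite /vsign; have -> : [fset u in H | (u < m)%R] = fset0.
  apply/fsetP => u; rewrite !inE; apply/negP => /andP[/mH].
  by rewrite leNgt => /negP.
by rewrite cardfs0.
Qed.

(** Removing the smallest vertex m carries the sign +1, and every other facet of the cone still
    contains m. *)
Lemma incidence_cone_base m G H : {in H, forall u, (m < u)%R} -> m \notin G ->
  inc G (m |` H) = (G == H)%:R.
Proof.
move=> mH mG; have mH' : m \notin H by apply/negP => /mH; rewrite ltxx.
have [->|GH] := eqVneq G H.
  rewrite -{1}(fsetU1K mH') incidence_facet ?fset1U1 // vsign_min // => u.
  by rewrite !inE => /predU1P[->|/mH/ltW].
apply: incidence_eq0 => v; rewrite !inE => /predU1P[->|vH].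
  by rewrite fsetU1K.
apply: contraNneq mG => ->; rewrite !inE eqxx andbT.
by apply: contraTneq vH => <-.
Qed.

(** The new smallest vertex precedes every v in H, which flips each sign; the base H of the cone
    avoids m and so is not the facet considered. *)
Lemma incidence_cone m G H : {in H, forall u, (m < u)%R} -> m \notin G ->
  inc (m |` G) (m |` H) = - inc G H.
Proof.
move=> mH mG; have mH' : m \notin H by apply/negP => /mH; rewrite ltxx.
rewrite !incidenceE big_mkcond (big_fsetD1 m) ?fset1U1 //= fsetU1K //.
have -> : (m |` G == H) = false.
  by apply: contraNF mH' => /eqP<-; rewrite fset1U1.
rewrite add0r -sumrN -big_mkcond big_seq_cond [RHS]big_seq_cond.
have E v : v \in H -> (m |` H) `\ v = m |` (H `\ v).
  move=> vH; apply/fsetP => u; rewrite !inE.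
  by have [->|//] := eqVneq u m; rewrite /= andbT; apply: contraTneq vH => <-.
apply: eq_big => v.
  apply: andb_id2l => vH; rewrite E //; apply/eqP/eqP => [|->//].
  by move=> /(congr1 (fun X => X `\ m)); rewrite !fsetU1K // !inE negb_and mH' orbT.
move=> /andP[vH _]; rewrite -[in RHS](fsetU1K mH') vsignD1 ?fset1U1 // mH //.
by rewrite mulN1r opprK.
Qed.
End Incidence.

(** * Boundary matrices *)

Section KernelMatrix.
Variable R : rcfType.
Implicit Types (F G H : {fset int}) (A B C D : {fset {fset int}}).
Implicit Types (f g : {fset int} -> {fset int} -> R).
Local Notation inc := (incidence R).

(** A general kernel in place of the incidence numbers lets matrix products and Gram matrices be
    computed as sums over faces. *)
Definition kernel_mx f A B : 'M[R]_(#|` B|, #|` A|) :=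
  \matrix_(i, j) f (nth fset0 B i) (nth fset0 A j).

Lemma kernel_mxM f g A B C :
  kernel_mx f A B *m kernel_mx g C A
  = kernel_mx (fun G F => \sum_(H <- A) f G H * g H F) C B.
Proof.
apply/matrixP => i j; rewrite !mxE (big_nth fset0) big_mkord /=.
by apply: eq_bigr => k _; rewrite !mxE.
Qed.

Lemma tr_kernel_mx f A B : (kernel_mx f A B)^T = kernel_mx (fun G F => f F G) B A.
Proof. by apply/matrixP => i j; rewrite !mxE. Qed.

Lemma eq_kernel_mx f g A B : (forall G F, G \in B -> F \in A -> f G F = g G F) ->
  kernel_mx f A B = kernel_mx g A B.
Proof. by move=> fg; apply/matrixP => i j; rewrite !mxE fg ?mem_nth. Qed.

Lemma kernel_mx_id A : kernel_mx (fun G F => (G == F)%:R) A A = 1%:M.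
Proof. by apply/matrixP => i j; rewrite !mxE nth_uniq ?fset_uniq ?ltn_ord. Qed.

Lemma kernel_mxD f g A B :
  kernel_mx (fun G F => f G F + g G F) A B = kernel_mx f A B + kernel_mx g A B.
Proof. by apply/matrixP => i j; rewrite !mxE. Qed.

Lemma kernel_mx0 A B : kernel_mx (fun _ _ => 0) A B = 0.
Proof. by apply/matrixP => i j; rewrite !mxE. Qed.

Lemma boundaryE A B : boundary R A B = kernel_mx inc A B.
Proof. by []. Qed.

Definition boundary_defect A B : {malg int[qmon R]} :=
  defect (boundary R A B *m (boundary R A B)^T).

Lemma boundary_defect_cols A A' B : A' `<=` A ->
    (forall F G, F \in A -> F \notin A' -> G \in B -> inc G F = 0) ->
  boundary_defect A B = boundary_defect A' B.
Proof.
move=> A'A inc0; rewrite /boundary_defect !boundaryE !tr_kernel_mx !kernel_mxM.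
congr defect; apply: eq_kernel_mx => G G' GB _.
rewrite [RHS](big_fset_incl _ A'A) // => F FA FA'.
by rewrite (inc0 F G) ?mul0r.
Qed.

(** Zero rows do not affect the transposed Gram matrix, which has the same defect by
    [defect_mulC]. *)
Lemma boundary_defect_rows A B B' : B' `<=` B ->
    (forall F G, F \in A -> G \in B -> G \notin B' -> inc G F = 0) ->
  boundary_defect A B = boundary_defect A B'.
Proof.
move=> B'B inc0; rewrite /boundary_defect ![defect (_ *m _^T)]defect_mulC.
rewrite !boundaryE !tr_kernel_mx !kernel_mxM.
congr defect; apply: eq_kernel_mx => F F' FA _.
rewrite [RHS](big_fset_incl _ B'B) // => G GB GB'.
by rewrite (inc0 F G) ?mul0r.
Qed.

Lemma boundary_defect_fset0 B : boundary_defect fset0 B = 0.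
Proof.
rewrite /boundary_defect boundaryE tr_kernel_mx kernel_mxM.
rewrite (eq_kernel_mx (g := fun _ _ => 0)) ?kernel_mx0 ?defect0 // => G G' _ _.
exact: big_seq_fset0.
Qed.

(* The Gram matrix of [U *m W] has the same nonzero eigenvalues as
   [W W^T U^T U = (1 + X X^T) (1 + Y^T Y) = 1 + X X^T + Y^T Y]. *)
Lemma defect_factor k l m n p (U : 'M[R]_(k, n)) (W : 'M[R]_(n, l))
    (X : 'M[R]_(n, m)) (Y : 'M[R]_(p, n)) :
    U^T *m U = 1%:M + Y^T *m Y -> W *m W^T = 1%:M + X *m X^T -> Y *m X = 0 ->
  defect (U *m W *m (U *m W)^T) =
    qpow 1 * (defect (X *m X^T) + defect (Y *m Y^T)) + (qpow 1 - 1) * n%:R.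
Proof.
move=> EU EW YX; rewrite trmx_mul -mulmxA defect_mulC -!mulmxA EU mulmxA EW.
have orth : X *m X^T *m (Y^T *m Y) = 0.
  by rewrite -mulmxA (mulmxA X^T) -trmx_mul YX trmx0 mul0mx mulmx0.
have -> : (1%:M + X *m X^T) *m (1%:M + Y^T *m Y) = 1%:M + (X *m X^T + Y^T *m Y).
  by rewrite mulmxDl mul1mx mulmxDr mulmx1 orth addr0 addrAC addrA.
rewrite defect_add1 => [|a].
  by rewrite (defect_add_orth orth) (defect_mulC Y^T).
(* The sum is the Gram matrix of the block row (X, Y^T), hence has nonnegative eigenvalues. *)
rewrite -{2}[Y]trmxK -mul_row_col -tr_row_mx; exact: gram_eigenvalue_ge0.
Qed.
End KernelMatrix.

(** * Exchange closure: shiftedness expressed by replacing one vertex *)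

Definition exchange_closed (V : {fset int}) (K : {fset {fset int}}) : Prop :=
  forall F i j, F \in K -> j \in F -> i \in V -> i \notin F -> (i < j)%R ->
  i |` (F `\ j) \in K.

Lemma exchange_closed_deletion V K e :
  exchange_closed V K -> exchange_closed (V `\ e) (deletion K e).
Proof.
move=> exK F i j; rewrite !in_deletion => /andP[FK eF] jF.
rewrite !inE => /andP[ie iV] iF ij; rewrite exK //=.
by rewrite negb_or eq_sym ie negb_and eF orbT.
Qed.

Lemma exchange_closed_contraction V K e :
  exchange_closed V K -> exchange_closed (V `\ e) (contraction K e).
Proof.
move=> exK H i j; rewrite !in_contraction => /andP[eH HK] jH.
rewrite !inE => /andP[ie iV] iH ij; rewrite negb_or eq_sym ie negb_and eH orbT /=.
have je : j != e by apply: contraTneq jH => ->.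
have -> : e |` (i |` H `\ j) = i |` ((e |` H) `\ j).
  apply/fsetP => u; rewrite !inE orbCA; congr (_ || _).
  by have [->|] := eqVneq u e; rewrite // eq_sym je.
apply: exK => //; first by rewrite !inE jH orbT.
by rewrite !inE negb_or ie.
Qed.

Lemma deletion_fpowersetD V K e :
  deletion (fpowerset V `\` K) e = fpowerset (V `\ e) `\` deletion K e.
Proof.
apply/fsetP => F; rewrite in_deletion !in_fsetD !fpowersetE in_deletion fsubsetD1.
by case: (e \in F); rewrite ?andbF ?andbT.
Qed.

Lemma contraction_fpowersetD V K e : e \in V ->
  contraction (fpowerset V `\` K) e = fpowerset (V `\ e) `\` contraction K e.
Proof.
move=> eV; apply/fsetP => F.
rewrite in_contraction !in_fsetD !fpowersetE in_contraction fsubsetD1.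
by rewrite fsubUset fsub1set eV; case: (e \in F); rewrite ?andbF ?andbT.
Qed.

(** * The inductive step at the smallest vertex *)

Section ConeStep.
Variables (R : rcfType) (V : {fset int}) (m : int).
Variables (K K' : {fset {fset int}}).
Hypothesis mV : m \in V.
Hypothesis m_min : {in V, forall u, (m <= u)%R}.
Hypothesis KV : K `<=` fpowerset V.
Hypothesis exK : exchange_closed V K.
Hypothesis exK' : exchange_closed V K'.
Local Notation inc := (incidence R).

Let V1 := V `\ m.
Let L := fpowerset V `\` K'.
Let L2 := fpowerset V1 `\` contraction K' m.
Let N := [fset H in contraction K m | H \notin K'].

Let m_lt H : H `<=` V -> m \notin H -> {in H, forall u, (m < u)%R}.
Proof.
move=> /fsubsetP HV mH u uH; rewrite lt_neqAle m_min ?HV // andbT.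
by apply: contraNneq mH => ->.
Qed.

Let subV F : F \in K -> F `<=` V.
Proof. by move=> /(fsubsetP KV); rewrite fpowersetE. Qed.

Let contrV H : H \in contraction K m -> H `<=` V.
Proof.
by rewrite in_contraction => /andP[_ /subV]; rewrite fsubUset => /andP[].
Qed.

Let NP H : H \in N -> [/\ m \notin H, {in H, forall u, (m < u)%R},
  H \in contraction K m & H \notin K'].
Proof.
rewrite !inE => /andP[HK HK']; have mH : m \notin H.
  by move: HK; rewrite in_contraction => /andP[].
by split=> //; apply: m_lt => //; apply: contrV.
Qed.

Let facet_contraction (M : {fset {fset int}}) F v : exchange_closed V M ->
  F \in M -> F `<=` V -> m \notin F -> v \in F -> F `\ v \in contraction M m.
Proof.
move=> exM FM FV mF vF; rewrite in_contraction !inE negb_and mF orbT /=.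
by apply: exM => //; apply: m_lt vF.
Qed.

(** Every facet of the cone over H lies in K': H by assumption, the others by exchanging a vertex of
    H for m. *)
Let incidence_cone_eq0 G H : G \in L -> H `<=` V -> m \notin H -> H \in K' ->
  inc G (m |` H) = 0.
Proof.
rewrite in_fsetD => /andP[GK' _] HV mH HK'; apply: incidence_eq0 => v vmH.
apply: contraNneq GK' => ->; move: vmH; rewrite !inE => /predU1P[->|vH].
  by rewrite fsetU1K.
have := facet_contraction exK' HK' HV mH vH; rewrite in_contraction => /andP[_].
suff -> : m |` (H `\ v) = (m |` H) `\ v by [].
apply/fsetP => u; rewrite !inE.
by have [->|//] := eqVneq u m; rewrite /= andbT; apply/esym; apply: contraTneq vH => <-.
Qed.

(** For F avoiding m this is the cone formula ∂(m * ∂F) = ∂F - m * ∂∂F = ∂F; for F containing m only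
    the facet F \ m enters. Facets in K/m but outside [N] lie in K' and contribute nothing to rows
    in [L], by [incidence_cone_eq0]. *)
Let boundary_factor : boundary R K L =
  kernel_mx (fun G H => inc G (m |` H)) N L *m boundary R K N.
Proof.
rewrite !boundaryE kernel_mxM; apply: eq_kernel_mx => G F GL FK.
have FV := subV FK.
have [GV GK'] : G `<=` V /\ G \notin K'.
  by move: GL; rewrite in_fsetD fpowersetE => /andP[].
rewrite (@sum_mul_incidence R N (fun H => inc G (m |` H))); apply/esym.
have [mF|mF] := boolP (m \in F).
  have -> : \sum_(v <- F | F `\ v \in N) inc G (m |` F `\ v) * vsign R F v =
            \sum_(v <- [fset m] | F `\ v \in N) inc G (m |` F `\ v) * vsign R F v.
    rewrite [LHS]big_mkcond [RHS]big_mkcond.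
    rewrite -(big_fset_incl _ (A := [fset m])) ?fsub1set // => v vF.
    rewrite inE => vm; case: ifP => // /NP[]; rewrite !inE mF andbT negbK.
    by rewrite eq_sym (negbTE vm).
  rewrite big_mkcond big_seq_fset1 fsetD1K // vsign_min => [|u uF]; last first.
    by apply: m_min; apply: (fsubsetP FV).
  case: ifPn => FN; first by rewrite mulr1.
  apply/esym; rewrite -(fsetD1K mF); apply: incidence_cone_eq0 => //.
  - exact: fsubset_trans (fsubD1set _ _) FV.
  - by rewrite !inE eqxx.
  - apply: contraNT FN => FK'; rewrite !inE FK' andbT in_contraction fsetD1K //.
    by rewrite FK !inE eqxx.
have mF_lt := m_lt FV mF.
have mFv v : m \notin F `\ v by rewrite !inE negb_and mF orbT.
have Fv_lt v : {in F `\ v, forall u, (m < u)%R}.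
  by move=> u; rewrite !inE => /andP[_ /mF_lt].
have FvV v : F `\ v `<=` V := fsubset_trans (fsubD1set _ _) FV.
have -> : \sum_(v <- F | F `\ v \in N) inc G (m |` F `\ v) * vsign R F v =
          \sum_(v <- F) inc G (m |` F `\ v) * vsign R F v.
  rewrite big_mkcond; apply: eq_big_seq => v vF; case: ifPn => // FN.
  rewrite incidence_cone_eq0 ?mul0r //; apply: contraNT FN => FK'.
  by rewrite !inE FK' andbT facet_contraction.
(* For m outside G the sum is the coefficient of G in ∂F; for m in G it is minus the coefficient of
   G \ m in ∂∂F. *)
have [mG|mG] := boolP (m \in G); last first.
  rewrite [RHS]incidenceE [RHS]big_mkcond; apply: eq_bigr => v _.
  rewrite incidence_cone_base //; case: eqP => _; by rewrite ?mul1r ?mul0r.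
rewrite [RHS]incidence_eq0 => [|v vF]; last first.
  by apply: contraTneq mG => ->.
(* [fpowerset F] contains every facet of F, so no term of ∂∂F is dropped. *)
have := @sum_incidence_sq R (fpowerset F) (G `\ m) F.
rewrite (@sum_mul_incidence R _ (inc (G `\ m))) => sq0.
rewrite -[RHS]oppr0 -[in RHS]sq0 => [|v w _ _ _]; last first.
  by rewrite fpowersetE fsubD1set.
rewrite -sumrN [RHS]big_mkcond; apply: eq_bigr => v _.
rewrite fpowersetE fsubD1set -(fsetD1K mG) incidence_cone ?mulNr ?fsetU1K //.
all: by rewrite !inE eqxx.
Qed.

(** Rows avoiding m give the identity, as [N] lies in [L]; rows that are cones over faces in [L2]
    give the second Gram matrix, the two signs from [incidence_cone] cancelling. *)
Let gram_rows :
  (kernel_mx (fun G H => inc G (m |` H)) N L)^T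
    *m kernel_mx (fun G H => inc G (m |` H)) N L
  = 1%:M + (boundary R N L2)^T *m boundary R N L2.
Proof.
rewrite !boundaryE !tr_kernel_mx !kernel_mxM -kernel_mx_id -kernel_mxD.
apply: eq_kernel_mx => H H' /NP[mH mH_lt HK HK'] /NP[mH' mH'_lt _ _].
rewrite (big_deletion_contraction _ m) contraction_fpowersetD //; congr (_ + _).
  rewrite (big_fsetD1 H) /=; last first.
    by rewrite in_deletion in_fsetD HK' fpowersetE contrV.
  rewrite incidence_cone_base // eqxx mul1r incidence_cone_base //.
  rewrite big1_seq ?addr0 // => G /=; rewrite in_fsetD1 in_deletion.
  case/and3P=> GH _ mG.
  by rewrite incidence_cone_base // (negbTE GH) mul0r.
apply: eq_big_seq => G; rewrite in_fsetD fpowersetE => /andP[_ GV1].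
have mG : m \notin G by apply/negP => /(fsubsetP GV1); rewrite !inE eqxx.
by rewrite !incidence_cone // mulrNN.
Qed.

(** Columns containing m give the identity; the others are indexed by [deletion K m]. *)
Let gram_columns :
  boundary R K N *m (boundary R K N)^T
  = 1%:M + boundary R (deletion K m) N *m (boundary R (deletion K m) N)^T.
Proof.
rewrite !boundaryE !tr_kernel_mx !kernel_mxM -kernel_mx_id -kernel_mxD.
apply: eq_kernel_mx => H H' /NP[mH mH_lt HK HK'] /NP[mH' mH'_lt _ _].
rewrite (big_deletion_contraction _ m) addrC; congr (_ + _).
rewrite (big_fsetD1 H) //= incidence_cone_base // eqxx mul1r.
rewrite incidence_cone_base // eq_sym big1_seq ?addr0 // => G /=.
rewrite in_fsetD1 => /andP[GH GK].
rewrite incidence_cone_base ?(eq_sym H) ?(negbTE GH) ?mul0r //.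
by apply: m_lt; [exact: contrV|move: GK; rewrite in_contraction => /andP[]].
Qed.

(** An intermediate face F \ v lies in K/m by exchange, and not in K', since otherwise exchange
    would put G in K'/m. *)
Let boundary_sq0 : boundary R N L2 *m boundary R (deletion K m) N = 0.
Proof.
rewrite !boundaryE kernel_mxM -(kernel_mx0 R (deletion K m) L2).
apply: eq_kernel_mx => G F GL; rewrite in_deletion => /andP[FK mF].
have FV := subV FK; apply: sum_incidence_sq => v w vF wF EG.
rewrite !inE facet_contraction //=; apply: contraL GL => FvK'.
rewrite in_fsetD negb_and negbK EG facet_contraction //.
  exact: fsubset_trans (fsubD1set _ _) FV.
by rewrite !inE negb_and mF orbT.
Qed.

Lemma boundary_defect_cone :
  boundary_defect R K (fpowerset V `\` K') =
  qpow 1 * (boundary_defect R (deletion K m) (fpowerset V1 `\` deletion K' m)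
            + boundary_defect R (contraction K m) (fpowerset V1 `\` contraction K' m))
  + (qpow 1 - 1) * #|` N|%:R.
Proof.
(* Facets of a face of K avoiding m lie in K/m, so all rows outside [N] vanish. *)
have -> : boundary_defect R (deletion K m) (fpowerset V1 `\` deletion K' m)
          = boundary_defect R (deletion K m) N.
  rewrite -deletion_fpowersetD; apply: boundary_defect_rows.
    apply/fsubsetP => H /NP[mH _ HK HK']; rewrite in_deletion in_fsetD mH HK'.
    by rewrite fpowersetE contrV.
  move=> F G; rewrite !in_deletion => /andP[FK mF] /andP[GL mG] GN.
  apply: incidence_eq0 => v vF; apply: contraNneq GN => GF.
  rewrite !inE GF facet_contraction ?subV //= -GF.
  by move: GL; rewrite in_fsetD => /andP[].
(* A column of K/m outside [N] lies in K', so its facets lie in K'/m and it vanishes. *)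
have -> : boundary_defect R (contraction K m) (fpowerset V1 `\` contraction K' m)
          = boundary_defect R N L2.
  apply: boundary_defect_cols.
    by apply/fsubsetP => H; rewrite !inE => /andP[].
  move=> H G HK HN; rewrite in_fsetD => /andP[GK' _].
  apply: incidence_eq0 => v vH; apply: contraNneq GK' => ->.
  have mH : m \notin H by move: HK; rewrite in_contraction => /andP[].
  apply: facet_contraction => //; last exact: contrV.
  by apply: contraNT HN => HK'; rewrite !inE HK HK'.
rewrite /boundary_defect boundary_factor.
exact: defect_factor gram_rows gram_columns boundary_sq0.
Qed.
End ConeStep.

(** * Weighted degree sequences *)

Definition below (V : {fset int}) (j : int) : nat :=
  #|` [fset u in V | (u < j)%R]|.

Definition degree (K K' : {fset {fset int}}) (j : int) : nat :=
  \sum_(F <- K) ((j \in F) && (F `\ j \notin K')).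

Lemma fset_min (V : {fset int}) : V != fset0 ->
  exists2 m, m \in V & {in V, forall u, (m <= u)%R}.
Proof.
case/fset0Pn => v; rewrite -(mem_sort <=%R).
have := sort_le_sorted V; case E: (sort _ _) => [//|m s] /= s_sorted _.
exists m; first by rewrite -(mem_sort <=%R) E mem_head.
move=> u; rewrite -(mem_sort <=%R) E inE => /predU1P[->//|].
exact: (allP (order_path_min le_trans s_sorted)).
Qed.

Lemma below_fsetD1 V e j : e \in V ->
  below V j = ((e < j)%R + below (V `\ e) j)%N.
Proof.
move=> eV; rewrite /below (cardfsD1 e) !inE eV /=; congr (_ + #|` _|)%N.
by apply/fsetP => u; rewrite !inE; case: (u == e).
Qed.

Lemma below_min V m : {in V, forall u, (m <= u)%R} -> below V m = 0%N.
Proof.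
move=> m_min; apply/eqP; rewrite cardfs_eq0; apply/eqP/fsetP => u.
by rewrite !inE; apply/negP => /andP[/m_min]; rewrite leNgt => /negP.
Qed.

Lemma sum_fset_bool (T : choiceType) (A : {fset T}) (P : pred T) :
  (\sum_(x <- A) P x)%N = #|` [fset x in A | P x]|.
Proof.
rewrite -(sum1_size (enum_fset _)) -big_fset_condE [RHS]big_mkcond.
by apply: eq_bigr => x _; case: (P x).
Qed.

Lemma cone_identity (A : comNzRingType) (q n x y : A) :
  q * ((q - 1) * x + (q - 1) * y) + (q - 1) * n = (q - 1) * (n + q * (x + y)).
Proof. by ring. Qed.

Lemma degree_split K K' e j : j != e ->
  degree K K' j = (degree (deletion K e) (deletion K' e) j
                   + degree (contraction K e) (contraction K' e) j)%N.
Proof.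
move=> je; rewrite /degree (big_deletion_contraction _ e); congr (_ + _).
  apply: eq_big_seq => F; rewrite in_deletion => /andP[_ eF].
  have eFj : e \notin F `\ j by rewrite !inE negb_and eF orbT.
  by rewrite in_deletion eFj andbT.
apply: eq_big_seq => H; rewrite in_contraction => /andP[eH _].
have eHj : e \notin H `\ j by rewrite !inE negb_and eH orbT.
rewrite in_contraction eHj [j \in _]in_fset1U (negbTE je) /=.
suff -> : (e |` H) `\ j = e |` (H `\ j) by [].
by apply/fsetP => u; rewrite !inE; case: (eqVneq u e) => // ->; rewrite eq_sym je.
Qed.

Lemma degree_vertex K K' e :
  degree K K' e = #|` [fset H in contraction K e | H \notin K']|.
Proof.
rewrite /degree (big_deletion_contraction _ e) big1_seq => [|F]; last first.
  by rewrite in_deletion => /and3P[_ _ /negbTE->].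
rewrite add0r -sum_fset_bool; apply: eq_big_seq => H.
by rewrite in_contraction => /andP[eH _]; rewrite !inE eqxx fsetU1K.
Qed.

Lemma card_deletion_contraction (D : {fset {fset int}}) e :
  #|` D| = (#|` deletion D e| + #|` contraction D e|)%N.
Proof. by rewrite -!sum1_size (big_deletion_contraction D e). Qed.

Section WeightedDegree.
Variables (A : comNzRingType) (q : A).

(** The degree sum of the defect formula, without its factor q - 1. *)
Definition weighted_degree (V : {fset int}) (K K' : {fset {fset int}}) : A :=
  \sum_(j <- V) q ^+ below V j * (degree K K' j)%:R.

(** The vertex m has weight q^0, and every other vertex has one vertex fewer below it once m is
    removed. The recursion matches [boundary_defect_cone]. *)
Lemma weighted_degree_cone (V : {fset int}) K K' (m : int) :
    m \in V -> {in V, forall u, (m <= u)%R} ->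
  weighted_degree V K K' =
  #|` [fset H in contraction K m | H \notin K']|%:R
  + q * (weighted_degree (V `\ m) (deletion K m) (deletion K' m)
         + weighted_degree (V `\ m) (contraction K m) (contraction K' m)).
Proof.
move=> mV m_min; rewrite /weighted_degree (big_fsetD1 m) //= below_min // mul1r.
rewrite degree_vertex -big_split mulr_sumr; congr (_ + _).
apply: eq_big_seq => j; rewrite !inE => /andP[jm jV].
rewrite (degree_split _ _ jm) (below_fsetD1 _ mV) lt_neqAle eq_sym jm m_min //.
by rewrite add1n exprS natrD /= -mulrDr mulrA.
Qed.

(** The exponents [below V j] run through 0, ..., |V| - 1, so this is a geometric sum. *)
Lemma sum_below (V : {fset int}) :
  (1 - q) * (\sum_(j <- V) q ^+ below V j) = 1 - q ^+ #|` V|.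
Proof.
elim: {V}_.+1 {-2}V (ltnSn #|` V|) => // n IHn V Vn.
have [->|V0] := eqVneq V fset0; first by rewrite big_seq_fset0 cardfs0 mulr0 subrr.
have [m mV m_min] := fset_min V0.
rewrite (big_fsetD1 m) //= below_min // [in RHS](cardfsD1 m) mV add1n exprS.
have -> : \sum_(j <- V `\ m) q ^+ below V j =
          q * \sum_(j <- V `\ m) q ^+ below (V `\ m) j.
  rewrite mulr_sumr; apply: eq_big_seq => j; rewrite !inE => /andP[jm jV].
  by rewrite (below_fsetD1 _ mV) lt_neqAle eq_sym jm m_min // add1n exprS.
rewrite mulrDr mulr1 mulrCA IHn; first by rewrite mulrBr mulr1 addrA subrK.
by move: Vn; rewrite (cardfsD1 m) mV.
Qed.

Lemma sum_below_lt (V : {fset int}) e :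
  (1 - q) * (\sum_(j <- V | (j < e)%R) q ^+ below V j) = 1 - q ^+ below V e.
Proof.
rewrite big_fset_condE -sum_below; congr (_ * _); apply: eq_big_seq => j.
rewrite !inE => /andP[jV je]; congr (q ^+ #|` _|); apply/fsetP => u; rewrite !inE.
by case: (ltP u j) => uj; rewrite ?andbF // (lt_trans uj je) !andbT.
Qed.

(** If F contains j but not e, exchanging j for the smaller e shows that F \ j lies in K/e. *)
Lemma exchange_degree_gt V K (e j : int) :
    exchange_closed V K -> e \in V -> (e < j)%R ->
  degree (deletion K e) (contraction K e) j = 0%N.
Proof.
move=> exK eV ej; rewrite /degree big1_seq // => F /=.
rewrite in_deletion => /andP[FK eF]; case: (boolP (j \in F)) => //= jF.
have eFj : e \notin F `\ j by rewrite !inE negb_and eF orbT.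
by rewrite in_contraction eFj exK.
Qed.

(** Faces through j that avoid e split by whether F \ j lies in K/e. Those with F \ j in K/e
    correspond to all H in K/e avoiding j, because exchanging e for j puts the cone of j over H into
    K; the faces through both j and e supply the H containing j. *)
Lemma exchange_degree_lt V K (e j : int) :
    exchange_closed V K -> j \in V -> (j < e)%R ->
  degree K fset0 j
  = (#|` contraction K e| + degree (deletion K e) (contraction K e) j)%N.
Proof.
move=> exK jV je; have je' : j != e by rewrite lt_eqF.
rewrite (degree_split _ _ je') deletion_fset0 contraction_fset0 [LHS]addnC.
have -> : degree (deletion K e) fset0 j =
  (#|` deletion (contraction K e) j| + degree (deletion K e) (contraction K e) j)%N.
  rewrite !degree_vertex -[LHS]sum1_size -big_fset_condE.
  rewrite (bigID (fun H => H \in contraction K e)) /= big_fset_condE.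
  rewrite [X in (_ + X)%N = _]big_fset_condE !sum1_size; congr (_ + _)%N.
    congr #|` _|; apply/fsetP => H.
    have : (H \in contraction (deletion K e) j) && (H \in contraction K e)
           = (H \in contraction K e) && (j \notin H).
      rewrite andbC; apply: andb_id2l; rewrite !in_contraction => /andP[eH eHK].
      case: (boolP (j \in H)) => //= jH; rewrite in_deletion.
      have := exK _ _ _ eHK (fset1U1 _ _) jV.
      by rewrite !inE !negb_or (eq_sym e) je' eH jH fsetU1K //= andbT; apply.
    move: (contraction (deletion K e) j) (contraction K e) => X Y.
    by rewrite !inE.
rewrite addnA; congr (_ + _)%N.
rewrite (card_deletion_contraction (contraction K e) j) addnC; congr (_ + _)%N.
by rewrite degree_vertex; congr #|` _|; apply/fsetP => H; rewrite !inE andbT.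
Qed.

(** Compare term by term. For j > e, removing e lowers the exponent by one and the pair has degree
    0. For j < e the exponent is unchanged, and [exchange_degree_lt] leaves an excess proportional
    to |K/e|. *)
Lemma weighted_degree_recursion (V : {fset int}) K (e : int) :
    exchange_closed V K -> e \in V ->
  weighted_degree V K fset0 = #|` contraction K e|%:R
    + q * (weighted_degree (V `\ e) (deletion K e) fset0
           + weighted_degree (V `\ e) (contraction K e) fset0)
    + (1 - q) * weighted_degree (V `\ e) (deletion K e) (contraction K e).
Proof.
move=> exK eV; set a := #|` contraction K e|.
have term j : j \in V `\ e -> q ^+ below V j * (degree K fset0 j)%:R =
    q * (q ^+ below (V `\ e) j * (degree (deletion K e) fset0 j)%:R
         + q ^+ below (V `\ e) j * (degree (contraction K e) fset0 j)%:R)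
    + (1 - q) * (q ^+ below (V `\ e) j * (degree (deletion K e) (contraction K e) j)%:R)
    + (if (j < e)%R then (1 - q) * q ^+ below V j * a%:R else 0).
  rewrite !inE => /andP[je jV]; rewrite (below_fsetD1 j eV).
  have Ds : degree K fset0 j = (degree (deletion K e) fset0 j
      + degree (contraction K e) fset0 j)%N.
    by rewrite (degree_split _ _ je) deletion_fset0 contraction_fset0.
  move: je; case: (ltgtP e j) => //= ej _.
    rewrite (exchange_degree_gt exK) // Ds natrD add1n exprS.
    by rewrite !mulr0 !addr0 -mulrA -mulrDr.
  have := exchange_degree_lt exK jV ej.
  rewrite -mulrDr -natrD -Ds add0n => ->; rewrite natrD.
  by move: (q ^+ _) (a%:R : A) (_%:R : A) => x y z; ring.
rewrite {1}/weighted_degree (big_fsetD1 e) //= (eq_big_seq _ term).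
rewrite !big_split /= -!mulr_sumr big_split /=.
have -> : (degree K fset0 e) = a.
  by rewrite degree_vertex; congr #|` _|; apply/fsetP => H; rewrite !inE andbT.
(* The excesses over j < e telescope; with the term of e itself they add up to exactly |K/e|. *)
have -> : \sum_(j <- V `\ e) (if (j < e)%R then (1 - q) * q ^+ below V j * a%:R else 0)
    = (1 - q ^+ below V e) * a%:R.
  rewrite -sum_below_lt mulr_sumr mulr_suml [RHS]big_mkcond.
  by rewrite [RHS](big_fsetD1 e) //= ltxx add0r.
rewrite -!/(weighted_degree _ _ _).
move: (q ^+ _) (a%:R : A) (weighted_degree _ (deletion K e) fset0) => x y z.
move: (weighted_degree _ _ (contraction K e)) (weighted_degree _ _ fset0) => u v.
ring.
Qed.
End WeightedDegree.

(** Both sides obey the same recursion at the smallest vertex. K and K' vary in the induction, since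
    each is replaced by its deletion and its contraction. *)
Lemma boundary_defect_exchange (R : rcfType) V K K' :
    K `<=` fpowerset V -> exchange_closed V K -> exchange_closed V K' ->
  boundary_defect R K (fpowerset V `\` K')
  = (qpow 1 - 1) * weighted_degree (qpow 1) V K K'.
Proof.
elim: {V}_.+1 {-2}V (ltnSn #|` V|) K K' => // n IHn V Vn K K' KV exK exK'.
have [V0|V0] := eqVneq V fset0.
  (* Over the empty vertex set K has at most the empty face, which has no facets. *)
  rewrite (@boundary_defect_cols _ K fset0); last 2 first.
  - exact: fsub0set.
  - move=> F G FK _ _; apply: incidence_eq0 => v.
    by move: (fsubsetP KV F FK); rewrite fpowersetE V0 fsubset0 => /eqP->.
  by rewrite boundary_defect_fset0 /weighted_degree V0 big_seq_fset0 mulr0.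
have [m mV m_min] := fset_min V0.
have V1n : (#|` V `\ m| < n)%N by move: Vn; rewrite (cardfsD1 m) mV.
have subV F : F \in K -> F `<=` V by move/(fsubsetP KV); rewrite fpowersetE.
rewrite (boundary_defect_cone R mV m_min KV exK exK').
rewrite (weighted_degree_cone _ _ _ mV m_min) !IHn //.
- exact: cone_identity.
- apply/fsubsetP => H; rewrite in_contraction fpowersetE fsubsetD1.
  by case/andP => -> /subV; rewrite fsubUset => /andP[_ ->].
- exact: exchange_closed_contraction.
- exact: exchange_closed_contraction.
- apply/fsubsetP => F; rewrite in_deletion fpowersetE fsubsetD1.
  by case/andP => /subV-> ->.
- exact: exchange_closed_deletion.
- exact: exchange_closed_deletion.
Qed.

(** * From the componentwise order to exchanges *)

(** Domination in any matching order means that s has at least as many entries below each threshold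
    as t, and these counts bound the sorted entries. *)
Lemma all2_sort (s t : seq int) : all2 <=%R s t ->
  all2 <=%R (sort <=%R s) (sort <=%R t).
Proof.
rewrite !all2E !size_sort => /andP[/eqP st le_st]; rewrite st eqxx.
have count_st y : (count (<= y)%R t <= count (<= y)%R s)%N.
  elim: s t st le_st => [|a s IHs] [|b t] //= [st] /andP[ab le_st].
  apply: leq_add; last exact: IHs.
  by case: (leP b y) => // by_; rewrite (le_trans ab by_).
apply/(all_nthP (0, 0)) => p; rewrite size_zip !size_sort st minnn => pt.
rewrite nth_zip ?size_sort //=.
apply: nth_count_le; first exact: sort_le_sorted.
(* The threshold is the entry of index p in sorted t, so more than p entries of t are at most y. *)
set y := nth _ _ _.
rewrite count_sort; apply: leq_trans (count_st y); rewrite ltnNge; apply/negP => tp.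
have := @nth_count_gt _ _ y 0 _ p (sort_le_sorted t).
by rewrite count_sort size_sort tp pt ltxx => /(_ isT).
Qed.

Lemma le_P_exchange (F : {fset int}) (i j : int) :
  j \in F -> i \notin F -> (i < j)%R -> le_P (i |` (F `\ j)) F.
Proof.
move=> jF iF ij; rewrite /le_P.
have -> : sort <=%R (i |` (F `\ j)) = sort <=%R (i :: F `\ j).
  apply/perm_sortP; [exact: le_total|exact: le_trans|exact: le_anti|].
  apply: uniq_perm; rewrite //= ?fset_uniq ?andbT //.
    by rewrite !inE negb_and iF orbT.
  by move=> u; rewrite !inE.
have -> : sort <=%R F = sort <=%R (j :: F `\ j).
  apply/perm_sortP; [exact: le_total|exact: le_trans|exact: le_anti|].
  apply: uniq_perm; rewrite //= ?fset_uniq ?andbT //.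
    by rewrite !inE eqxx.
  by move=> u; rewrite !inE; case: eqVneq => // ->.
apply: all2_sort; rewrite /= ltW //=.
by elim: (F `\ j : seq int) => //= u s ->; rewrite lexx.
Qed.

Lemma exchange_closed_faces V D k : is_complex V D -> shifted V D ->
  exchange_closed V (faces D k).
Proof.
move=> [DV _] sD F i j FD jF iV iF ij.
have FV : F `<=` V by apply: DV; move: FD; rewrite !inE => /andP[].
apply: (sD k _ F) => //; last exact: le_P_exchange.
by rewrite fsubUset fsub1set iV (fsubset_trans (fsubD1set _ _) FV).
Qed.

(** * Spectra of pairs *)

Lemma deletion_faces D e i : deletion (faces D i) e = faces (deletion D e) i.
Proof. by apply/fsetP => F; rewrite !inE; case: (F \in D); rewrite // andbC. Qed.

Lemma in_faces D i F : (F \in faces D i) = (F \in D) && (fdim F == i).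
Proof. by rewrite !inE. Qed.

Lemma fdimU1 e F : e \notin F -> fdim (e |` F) = fdim F + 1.
Proof. by move=> eF; rewrite /fdim cardfsU1 eF add1n intS [1 + _]addrC addrK subrK. Qed.

Lemma fdimD1 F v : v \in F -> fdim (F `\ v) = fdim F - 1.
Proof.
by move=> vF; rewrite -{2}(fsetD1K vF) fdimU1 ?addrK // !inE eqxx.
Qed.

Lemma contraction_faces D e i :
  contraction (faces D i) e = faces (contraction D e) (i - 1).
Proof.
apply/fsetP => H; rewrite in_contraction !in_faces in_contraction.
case: (boolP (e \in H)) => //= eH; rewrite fdimU1 //.
by rewrite [in RHS]eq_sym subr_eq eq_sym.
Qed.

Lemma faces_fset0 i : faces fset0 i = fset0.
Proof. by apply/fsetP => F; rewrite in_faces !inE. Qed.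

Lemma rank_identity (A : comNzRingType) (q g x y z : A) :
  (q - 1) * (g + q * (x + y) + (1 - q) * z)
  = (q - 1) * g + q * ((q - 1) * x + (q - 1) * y) + (1 - q) * ((q - 1) * z).
Proof. by ring. Qed.

Lemma spectrum_identity (A : comNzRingType) (q h g1 g0 a1 a0 b1 b0 c1 c0 : A) :
  h + g1 + g0 + ((q - 1) * g1 + q * (a1 + b1) + (1 - q) * c1
                 + ((q - 1) * g0 + q * (a0 + b0) + (1 - q) * c0))
  = q * (h + g1 + (a1 + a0)) + q * (g0 + (b1 + b0)) + (1 - q) * (h + (c1 + c0)).
Proof. by ring. Qed.

Section SpectrumCoefficients.
Variable R : rcfType.
Local Notation q := (qpow (1 : R)).
Implicit Types (D : {fset {fset int}}) (i : int).

Definition spectrum_sum D (D' : {fset {fset int}}) i : {malg int[qmon R]} :=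
  \sum_(x <- spectrum R D D' i) qpow x.

Definition pair_defect D (D' : {fset {fset int}}) i : {malg int[qmon R]} :=
  boundary_defect R (faces (D `\` D') i) (faces (D `\` D') (i - 1)).

Lemma spectrum_sum_eq0 D D' i : faces (D `\` D') i = fset0 -> spectrum_sum D D' i = 0.
Proof.
move=> D0; rewrite /spectrum_sum /spectrum; move: (laplacian _ _ _ _).
rewrite D0 cardfs0 => A.
by rewrite sum_qpow_eigenvalues (flatmx0 A) defect0 addr0.
Qed.

Lemma coef_spectrum_poly D D' n :
  (spectrum_poly R D D')`_n = spectrum_sum D D' (n%:Z - 1).
Proof.
rewrite coef_poly; case: ltnP => // ltn; rewrite spectrum_sum_eq0 //.
apply/fsetP => F; rewrite in_faces [RHS]inE; apply/negP => /andP[FD].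
rewrite /fdim (inj_eq (addIr _)) => /eqP[nF]; move: ltn; rewrite -nF ltnNge.
by rewrite (leq_bigmax_seq (F := fun F : {fset int} => #|` F|)).
Qed.

(** A face between F in D and G outside D' is again in D and outside D', so no middle face is
    missing. *)
Lemma boundary_sq0_pair V V' D D' i : is_complex V D -> is_complex V' D' ->
  let C := faces (D `\` D') in
  boundary R (C i) (C (i - 1)) *m boundary R (C (i + 1)) (C i) = 0.
Proof.
move=> [_ Dd] [_ Dd'] C; rewrite !boundaryE kernel_mxM -(kernel_mx0 R (C (i + 1))).
apply: eq_kernel_mx => G F; rewrite !in_faces !in_fsetD => /andP[/andP[GD' _] _].
case/andP=> /andP[_ FD] /eqP Fi; apply: sum_incidence_sq => v w vF _ EG.
rewrite in_faces in_fsetD fdimD1 // Fi addrK eqxx andbT (Dd _ _ FD) ?fsubD1set //.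
by rewrite andbT; apply: contra GD' => /Dd'; apply; rewrite EG fsubD1set.
Qed.

(** The two summands of the Laplacian are orthogonal because ∂∂ = 0, and the face count restores the
    normalisation of the defect. *)
Lemma spectrum_sumE V V' D D' i : is_complex V D -> is_complex V' D' ->
  spectrum_sum D D' i =
  #|` faces (D `\` D') i|%:R + (pair_defect D D' (i + 1) + pair_defect D D' i).
Proof.
move=> cD cD'; rewrite /spectrum_sum sum_qpow_eigenvalues; congr (_ + _).
rewrite /laplacian defect_add_orth; last first.
  rewrite -mulmxA (mulmxA _^T) -trmx_mul (boundary_sq0_pair i cD cD').
  by rewrite trmx0 mul0mx mulmx0.
by rewrite /pair_defect /boundary_defect addrK [defect (_^T *m _)]defect_mulC.
Qed.

(** This gives the form required by [boundary_defect_exchange]: an added column F in D' has all its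
    facets in D', and an added row is no facet of a face of D, so both vanish. *)
Lemma pair_defectE V V' D D' i : is_complex V D -> is_complex V' D' ->
  pair_defect D D' i =
  boundary_defect R (faces D i) (fpowerset V `\` faces D' (i - 1)).
Proof.
move=> [DV Dd] [_ Dd'].
rewrite [RHS](@boundary_defect_cols _ _ (faces (D `\` D') i)).
- apply/esym; apply: boundary_defect_rows.
    apply/fsubsetP => G; rewrite !(in_faces, in_fsetD) fpowersetE negb_and.
    by case/andP => /andP[-> /DV->].
  move=> F G; rewrite !(in_faces, in_fsetD) => /andP[/andP[_ FD] /eqP Fi].
  move=> /andP[GD' _] GDD'; apply: incidence_eq0 => v vF.
  apply: contraNneq GD' => EG; move: GDD'.
  have -> : fdim G == i - 1 by rewrite EG fdimD1 // Fi.
  by rewrite (Dd _ _ FD) ?EG ?fsubD1set // !andbT negbK.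
- by apply/fsubsetP => F; rewrite !in_faces in_fsetD => /andP[/andP[_ ->]].
move=> F G; rewrite !(in_faces, in_fsetD) => /andP[FD Fi].
rewrite FD Fi !andbT negbK => FD' /andP[GD' _]; apply: incidence_eq0 => v vF.
apply: contraNneq GD' => ->; rewrite fdimD1 // (eqP Fi) eqxx andbT.
by apply: Dd' FD' _; exact: fsubD1set.
Qed.
Lemma is_complex_fset0 V : is_complex V fset0.
Proof. by split=> [F|F G]; rewrite inE. Qed.

Lemma pair_defect_recursion V D e i : is_complex V D -> shifted V D -> e \in V ->
  pair_defect D fset0 i =
  (q - 1) * #|` faces (contraction D e) (i - 1)|%:R
  + q * (pair_defect (deletion D e) fset0 i
         + pair_defect (contraction D e) fset0 (i - 1))
  + (1 - q) * pair_defect (deletion D e) (contraction D e) i.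
Proof.
move=> cD sD eV.
have exD k : exchange_closed V (faces D k) by exact: exchange_closed_faces.
have cdel := is_complex_deletion e cD; have ccon := is_complex_contraction e cD.
have c0 W := is_complex_fset0 W.
have faces_sub W B k : is_complex W B -> faces B k `<=` fpowerset W.
  move=> [BW _]; apply/fsubsetP => F; rewrite in_faces fpowersetE.
  by case/andP => /BW.
have ex0 W : exchange_closed W fset0 by move=> F k l; rewrite inE.
have exdel k : exchange_closed (V `\ e) (faces (deletion D e) k).
  by rewrite -deletion_faces; apply: exchange_closed_deletion.
have excon k : exchange_closed (V `\ e) (faces (contraction D e) k).
  (* Contraction lowers dimension, so these faces come from those of D of dimension k + 1. *)
  rewrite -[k](addrK 1) -contraction_faces; exact: exchange_closed_contraction.
rewrite (pair_defectE _ cD (c0 V)) (pair_defectE _ cdel (c0 V)).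
rewrite (pair_defectE _ ccon (c0 V)) (pair_defectE _ cdel ccon) !faces_fset0.
rewrite !boundary_defect_exchange //; try exact: faces_sub.
rewrite (weighted_degree_recursion _ (exD i) eV) deletion_faces contraction_faces.
exact: rank_identity.
Qed.

(** The defects at i and i + 1 both satisfy the recursion; their terms counting faces of the
    contraction combine with the face counts of [spectrum_sumE]. *)
Lemma spectrum_sum_recursion V D e i : is_complex V D -> shifted V D -> e \in V ->
  spectrum_sum D fset0 i =
  q * spectrum_sum (deletion D e) fset0 i
  + q * spectrum_sum (contraction D e) fset0 (i - 1)
  + (1 - q) * spectrum_sum (deletion D e) (contraction D e) i.
Proof.
move=> cD sD eV; have c0 := is_complex_fset0 V.
have cdel := is_complex_deletion e cD; have ccon := is_complex_contraction e cD.
rewrite (spectrum_sumE _ cD c0) (spectrum_sumE _ cdel c0).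
rewrite (spectrum_sumE _ ccon c0) (spectrum_sumE _ cdel ccon) !fsetD0 subrK.
rewrite !(pair_defect_recursion _ cD sD eV) addrK.
rewrite (card_deletion_contraction (faces D i) e) deletion_faces contraction_faces.
(* D is closed under subsets, so D/e is contained in D - e. *)
have -> : #|` faces (deletion D e) i| =
    (#|` faces (deletion D e `\` contraction D e) i|
     + #|` faces (contraction D e) i|)%N.
  have sub : faces (contraction D e) i `<=` faces (deletion D e) i.
    apply/fsubsetP => F; rewrite !in_faces in_contraction in_deletion.
    case/andP => /andP[-> eFD] ->; rewrite !andbT.
    by case: cD => _; apply; [exact: eFD|exact: fsubsetU1].
  rewrite -(cardfsID (faces (contraction D e) i)) (fsetIidPr sub) addnC.
  congr (_ + _)%N; congr #|` _|; apply/fsetP => F.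
  rewrite in_fsetD !in_faces in_fsetD.
  by case: (fdim F == i); rewrite ?andbF ?andbT.
rewrite !natrD; exact: spectrum_identity.
Qed.
End SpectrumCoefficients.

(** * Comparison of the coefficients in t *)

Theorem theorem4p23 (R : realType) (V : {fset int}) (D : {fset {fset int}})
    (hD : is_complex V D) (hs : shifted V D) (e : int) (he : e \in V) :
  let S := spectrum_poly R in
  let t := tvar R in
  let q := qvar R in
  S D fset0 = q * S (deletion D e) fset0
              + q * t * S (contraction D e) fset0
              + (1 - q) * S (deletion D e) (contraction D e).
Proof.
move=> S t q; apply/polyP => n.
have coef_tS : (t * S (contraction D e) fset0)`_n
             = spectrum_sum R (contraction D e) fset0 (n%:Z - 1 - 1).
  rewrite coefXM coef_spectrum_poly.
  case: n => [|n] /=; last by rewrite intS [1 + _]addrC addrK.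
  (* At n = 0 the shifted index is -2, a dimension in which there are no faces. *)
  apply/esym/spectrum_sum_eq0/fsetP => F; rewrite in_faces [RHS]inE.
  apply/negP => /andP[_ /eqP /(congr1 (+%R^~ 1))]; rewrite !subrK => F_lt0.
  by have := le0z_nat #|` F|; rewrite F_lt0.
rewrite /q /qvar -polyC1 -polyCB !coefD -mulrA !coefCM coef_tS.
rewrite !coef_spectrum_poly; exact: (spectrum_sum_recursion _ _ hD hs he).
Qed.
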